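(* Consider an instance of an uncertainty problem (such as the minimum, sorting, or MST problem under uncertainty) with $n$ uncertainty intervals $\mathcal{I}$, for which the set $\mathcal{I}_w$ of mandatory intervals (and hence $k_M$) can be computed in polynomial time from a realization $w$. Suppose the true values $w$ are drawn from an unknown distribution $D$ and i.i.d. samples from $D$ can be obtained. For any $\varepsilon, \delta \in (0,1)$, there exists a learning algorithm that, using a training set of size $m \in \mathcal{O}\left(\frac{(n - \log(\delta))\cdot n^2}{\varepsilon^2}\right)$, returns a predicted set of mandatory intervals $P \in \mathcal{P}$ in time polynomial in $n$ and $m$, such that $\mathbb{E}_{w \sim D}[k_M(\mathcal{I}_w,P)] \le \mathbb{E}_{w \sim D}[k_M(\mathcal{I}_w,P^* )] + \varepsilon$ holds with probability at least $1-\delta$, where $P^* = \arg\min_{P' \in \mathcal{P}} \mathbb{E}_{w \sim D}[k_M(\mathcal{I}_w,P')]$.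
   Context: Each uncertain element has an interval $I_i$ (open or trivial) and a true value $w_i\in I_i$; a query reveals $w_i$. A query set is feasible if the problem's answer (e.g. the minimum element of each set, the order of each set, or an MST) is the same for all value assignments in the intervals agreeing with the true values on it. For a realization $w$, $\mathcal{I}_w$ denotes the set of intervals contained in every feasible query set (mandatory intervals). $\mathcal{P}$ is the power set of $\mathcal{I}$, and for $P\in\mathcal{P}$, $k_M(\mathcal{I}_w,P)=|P\triangle\mathcal{I}_w|$. *)

(* Defs.v *)
From HB Require Import structures.
From mathcomp Require Import all_boot all_order all_algebra.
From mathcomp Require Import all_classical all_reals all_analysis.

Set Implicit Arguments.
Unset Strict Implicit.
Unset Printing Implicit Defensive.

Import Order.TTheory GRing.Theory Num.Theory.
Local Open Scope classical_set_scope.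
Local Open Scope ring_scope.

(** * Instances and problems

    The uncertain elements are indexed by ['I_n]; a set of intervals is a
    [{set 'I_n}] and an assignment of values to them is an [n.-tuple R]. *)

(** [answer w a] means that [a] is a correct answer for the values [w]. It is a
    relation because answers need not be unique (several minimum elements or
    several MSTs when values are tied); a problem whose answer is a function
    [f] of the values is the case [answer w a := f w = a]. *)
Record uinstance (R : realType) (n : nat) := UInstance {
  lo : 'I_n -> R;
  hi : 'I_n -> R;
  lo_le_hi : forall i, lo i <= hi i;
  ans : Type;
  answer : n.-tuple R -> ans -> Prop }.

Section Instance.
Context (R : realType) (n : nat) (I : uinstance R n).
Implicit Types (w : n.-tuple R) (Q P : {set 'I_n}).

Definition uinterval (i : 'I_n) : set R :=
  if lo I i == hi I i then [set lo I i] else `]lo I i, hi I i[%classic.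

Definition realizations : set (n.-tuple R) :=
  [set w | forall i, uinterval i (tnth w i)].

Definition feasible w Q : Prop :=
  exists a : ans I, forall w', realizations w' ->
    (forall i, i \in Q -> tnth w' i = tnth w i) -> answer w' a.

(** [mandatory w] is the set written I_w. *)
Definition mandatory w : {set 'I_n} :=
  [set i | `[< forall Q, feasible w Q -> i \in Q >]]%SET.

Definition kM (A P : {set 'I_n}) : nat := #|(P :\: A) :|: (A :\: P)|.

End Instance.

(** * Computation

    Running time is measured in a real-RAM (unit-cost exact arithmetic on real
    numbers) presented as a small first-order language whose data are pointers
    to pairs and whose atoms are real numbers. The only constants are natural
    numbers. *)

Inductive val (R : Type) := VNil | VReal of R | VPair of val R & val R.
Arguments VNil {R}.

Inductive prog :=
| PId | PNil | PNat of nat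
| PPair of prog & prog | PFst | PSnd | PIsPair
| PAdd | PSub | PMul | PDiv | PLt
| PComp of prog & prog
| PIf of prog & prog & prog
| PWhile of prog & prog.

Section Semantics.
Context (R : realType).
Notation val := (val R).

Definition VBool (b : bool) : val := VReal b%:R.

Definition is_pair (v : val) : bool := if v is VPair _ _ then true else false.

(** [eval p v u t]: on input [v], program [p] halts with output [u] after
    exactly [t] steps. *)
Inductive eval : prog -> val -> val -> nat -> Prop :=
| EId v : eval PId v v 1
| ENil v : eval PNil v VNil 1
| ENat k v : eval (PNat k) v (VReal k%:R) 1
| EPair p q v u1 u2 t1 t2 :
    eval p v u1 t1 -> eval q v u2 t2 ->
    eval (PPair p q) v (VPair u1 u2) (t1 + t2).+1
| EFst u1 u2 : eval PFst (VPair u1 u2) u1 1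
| ESnd u1 u2 : eval PSnd (VPair u1 u2) u2 1
| EIsPair v : eval PIsPair v (VBool (is_pair v)) 1
| EAdd x y : eval PAdd (VPair (VReal x) (VReal y)) (VReal (x + y)) 1
| ESub x y : eval PSub (VPair (VReal x) (VReal y)) (VReal (x - y)) 1
| EMul x y : eval PMul (VPair (VReal x) (VReal y)) (VReal (x * y)) 1
| EDiv x y : eval PDiv (VPair (VReal x) (VReal y)) (VReal (x / y)) 1
| ELt x y : eval PLt (VPair (VReal x) (VReal y)) (VBool (x < y)) 1
| EComp p q v u1 u2 t1 t2 :
    eval q v u1 t1 -> eval p u1 u2 t2 -> eval (PComp p q) v u2 (t1 + t2).+1
| EIfT c p q v u t1 t2 :
    eval c v (VBool true) t1 -> eval p v u t2 ->
    eval (PIf c p q) v u (t1 + t2).+1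
| EIfF c p q v u t1 t2 :
    eval c v (VBool false) t1 -> eval q v u t2 ->
    eval (PIf c p q) v u (t1 + t2).+1
| EWhileT c p v u1 u2 t1 t2 t3 :
    eval c v (VBool true) t1 -> eval p v u1 t2 -> eval (PWhile c p) u1 u2 t3 ->
    eval (PWhile c p) v u2 (t1 + t2 + t3).+1
| EWhileF c p v t1 :
    eval c v (VBool false) t1 -> eval (PWhile c p) v v t1.+1.

Lemma eval_det p v u u' t t' : eval p v u t -> eval p v u' t' -> u = u' /\ t = t'.
Proof.
have TF : VBool true <> VBool false.
  by case=> /eqP; rewrite oner_eq0.
move=> e; elim: e u' t' => {p v u t}.
all: try by move=> *; match goal with H : eval _ _ _ _ |- _ => inversion H end.
all: intros.
all: match goal with H : eval _ _ _ _ |- _ =>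
       match type of H with eval _ _ ?z _ =>
         match goal with |- _ = z /\ _ => inversion H; clear H end end end; subst.
all: repeat match goal with
  IH : (forall _ _, eval ?p ?v _ _ -> _ = _ /\ _ = _), H : eval ?p ?v _ _ |- _ =>
    case: (IH _ _ H) => ? ?; clear H; subst end.
all: try by split.
all: try by case: TF; congruence.
Qed.

Definition enc_seq (s : seq val) : val := foldr (@VPair R) VNil s.

Definition enc_values n (w : n.-tuple R) : val := enc_seq (map (@VReal R) w).

Definition enc_set n (P : {set 'I_n}) : val :=
  enc_seq [seq VBool (i \in P) | i <- enum 'I_n].

End Semantics.

(** An uncertainty problem is a family of instances, so that polynomial running
    time is meaningful. [descr] is the part of the input other than the
    intervals (a family of sets, a graph, ...), as machine data. *)
Record uproblem (R : realType) := UProblem {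
  input : nat -> Type;
  inst : forall n, input n -> uinstance R n;
  descr : forall n, input n -> val R }.

Section Problem.
Context (R : realType) (Pi : uproblem R).

Definition enc_input n (x : input Pi n) : val R :=
  VPair (enc_seq [seq VPair (VReal (lo (inst x) i)) (VReal (hi (inst x) i))
                 | i <- enum 'I_n])
        (descr x).

Definition mandatory_polytime : Prop :=
  exists (M : prog) (p : {poly nat}),
  forall n (x : input Pi n) (w : n.-tuple R), realizations (inst x) w ->
  exists2 t, (t <= p.[n])%N &
    eval M (VPair (enc_input x) (enc_values w))
           (enc_set R (mandatory (inst x) w)) t.

(** Program [L], given the input [x] and a training set [s] of [m]
    realizations, outputs [A s] within [T] steps. *)
Definition learner_computes (L : prog) n (x : input Pi n) m
    (A : m.-tuple (n.-tuple R) -> {set 'I_n}) (T : nat) : Prop :=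
  forall s : m.-tuple (n.-tuple R),
  (forall j, realizations (inst x) (tnth s j)) ->
  exists2 t, (t <= T)%N &
    eval L (VPair (enc_input x) (enc_seq (map (@enc_values R n) s)))
           (enc_set R (A s)) t.

End Problem.

(** * Probability *)

(** Makes the random set I_w, hence each k_M(I_w, P), measurable. *)
Definition measurable_mandatory (R : realType) n (I : uinstance R n) : Prop :=
  forall i : 'I_n, measurable [set w : n.-tuple R | i \in mandatory I w].

Definition risk (R : realType) n (I : uinstance R n)
    (D : probability (n.-tuple R) R) (P : {set 'I_n}) : \bar R :=
  'E_D[fun w => (kM (mandatory I w) P)%:R].

Definition opt_prediction (R : realType) n (I : uinstance R n)
    (D : probability (n.-tuple R) R) : {set 'I_n} :=
  [arg min_(P < finset.set0) risk I D P]%O.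

Definition iid (R : realType) (d d' : measure_display)
    (Om : measurableType d) (Pr : probability Om R)
    (T : measurableType d') (D : probability T R) m (W : 'I_m -> Om -> T) :=
  [/\ forall j, measurable_fun [set: Om] (W j),
      forall j (B : set T), measurable B -> Pr (W j @^-1` B) = D B &
      forall (J : {set 'I_m}) (B : 'I_m -> set T),
        (forall j, measurable (B j)) ->
        Pr (\bigcap_(j in [set` J]) (W j @^-1` B j)) =
        (\prod_(j in J) Pr (W j @^-1` B j))%E].

(* Main.v *)
(** The expected size of [P] symmetric difference [I_w] is a sum over the
    elements [i] of the probability that membership of [i] in [I_w] is not as
    predicted by [P], so the elements can be treated separately. The learner
    takes the majority vote of the samples on each [i]. A vote for the less
    likely answer costs [|1 - 2 p_i|], which is harmless when it is at most
    [eps / n]; otherwise such a vote has probability at most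
    [exp (- m (eps / n)^2 / 2)] by an exponential moment bound, and a union
    bound over the [n] elements concludes. Since the learner does not depend on
    the optimal prediction, the bound holds against every prediction [P']. *)

Require Import Defs.
From HB Require Import structures.
From mathcomp Require Import all_boot all_order all_algebra.
From mathcomp Require Import all_classical all_reals all_analysis.
From mathcomp Require Import measurable_realfun zify ring lra.

Set Implicit Arguments.
Unset Strict Implicit.
Unset Printing Implicit Defensive.

Import Order.TTheory GRing.Theory Num.Theory.
Local Open Scope classical_set_scope.
Local Open Scope ring_scope.

(** * Machine programs for the majority vote *)

Definition majority n (s : seq {set 'I_n}) : {set 'I_n} :=
  [set i | size s < 2 * count (fun S : {set 'I_n} => i \in S) s]%SET%N.

(** The loop state is a pair (remaining list, accumulator); [g] maps the whole state, whose current
    head sits at [PComp PFst PFst], to the next accumulator. *)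
Definition fold_prog (g : prog) : prog :=
  PWhile (PComp PIsPair PFst) (PPair (PComp PSnd PFst) g).

(** Results are pushed on the front of the accumulator, so the list comes out mapped and
    reversed. *)
Definition rmap_prog (f : prog) : prog :=
  PComp PSnd (PComp (fold_prog (PPair f PSnd)) (PPair PId PNil)).

Definition rev_prog : prog := rmap_prog (PComp PFst PFst).

Definition zeros_prog : prog := rmap_prog (PNat 0).

Definition threshold_prog : prog :=
  PComp rev_prog (rmap_prog (PComp PLt (PPair (PNat 0) (PComp PFst PFst)))).

(* The loop state is (remaining bits, (remaining scores, new scores reversed)). *)
Definition vote_prog : prog :=
  let bit := PComp PFst PFst in
  let score := PComp PFst (PComp PFst PSnd) in
  PComp rev_prog (PComp (PComp PSnd PSnd) (fold_prog
    (PPair (PComp PSnd (PComp PFst PSnd))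
       (PPair (PComp PAdd (PPair score
                (PComp PSub (PPair (PComp PAdd (PPair bit bit)) (PNat 1)))))
              (PComp PSnd PSnd))))).

(** The loop state is (remaining samples, (instance, scores)). Mapping the interval list to zeros
    yields the [n] initial scores. *)
Definition majority_prog (M : prog) : prog :=
  PComp (PComp threshold_prog (PComp PSnd PSnd))
    (PComp
      (fold_prog (PPair (PComp PFst PSnd)
        (PComp vote_prog
          (PPair (PComp M (PPair (PComp PFst PSnd) (PComp PFst PFst)))
                 (PPair (PComp PSnd PSnd) PNil)))))
      (PPair PSnd (PPair PFst (PComp zeros_prog (PComp PFst PFst))))).

(** * Correctness and running times of the programs *)

Section Programs.
Context (R : realType).
Local Notation val := (Defs.val R).
Local Notation eval := (@Defs.eval R).
Implicit Types (p q f g : prog) (u v st : val) (s out : seq val).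

Definition runs p v u T := exists2 t, (t <= T)%N & eval p v u t.

Lemma eval_runs p v u t T : eval p v u t -> (t <= T)%N -> runs p v u T.
Proof. by exists t. Qed.

Lemma runs_le p v u T T' : (T <= T')%N -> runs p v u T -> runs p v u T'.
Proof. by move=> TT' [t tT e]; exists t => //; apply: leq_trans TT'. Qed.

Lemma runs_comp p q v u u' T T' :
  runs q v u T -> runs p u u' T' -> runs (PComp p q) v u' (T + T').+1.
Proof.
by move=> [t tT e] [t' tT' e']; exists (t + t').+1; [lia | apply: EComp e e'].
Qed.

Lemma runs_pair p q v u u' T T' :
  runs p v u T -> runs q v u' T' -> runs (PPair p q) v (VPair u u') (T + T').+1.
Proof.
by move=> [t tT e] [t' tT' e']; exists (t + t').+1; [lia | apply: EPair e e'].
Qed.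

Lemma runs_fold_nil g st :
  runs (fold_prog g) (VPair (enc_seq [::]) st) (VPair VNil st) 4.
Proof.
apply: eval_runs; first apply: EWhileF.
  by apply: (EComp (EFst _ _)); apply: EIsPair.
by [].
Qed.

Lemma runs_fold_cons g (h : val) s st st' u T T' :
  runs g (VPair (VPair h (enc_seq s)) st) st' T ->
  runs (fold_prog g) (VPair (enc_seq s) st') u T' ->
  runs (fold_prog g) (VPair (enc_seq (h :: s)) st) u (T + T' + 8).
Proof.
move=> [t tT e] [t' tT' e'].
(* Three steps for the loop test, three for the tail, one each for the pairing and the loop. *)
exists (3 + (3 + t).+1 + t').+1; first by lia.
apply: EWhileT e'; first by apply: (EComp (EFst _ _)); apply: EIsPair.
by apply: EPair => //; apply: (EComp (EFst _ _)); apply: ESnd.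
Qed.

Lemma runs_rmap f (X : Type) (e F : X -> val) (s : seq X) T :
  (forall x tl st, runs f (VPair (VPair (e x) tl) st) (F x) T) ->
  runs (rmap_prog f) (enc_seq (map e s)) (enc_seq (rev (map F s)))
    ((T + 10) * size s + 10).
Proof.
move=> fF.
have loop out : runs (fold_prog (PPair f PSnd))
    (VPair (enc_seq (map e s)) (enc_seq out))
    (VPair VNil (enc_seq (catrev (map F s) out))) ((T + 10) * size s + 4).
  elim: s out => [|x s IHs] out; first by apply: (runs_le _ (runs_fold_nil _ _)); rewrite leq_addl.
  rewrite /= mulnS; apply: runs_le; last first.
    apply: (runs_fold_cons _ (IHs (F x :: out))).
    by apply: runs_pair (fF _ _ _) (eval_runs (ESnd _ _) (leqnn _)).
  by lia.
have init v : runs (PPair PId PNil) v (VPair v VNil) 3.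
  exact: eval_runs (EPair (EId _) (ENil _)) _.
have fin v u : runs PSnd (VPair v u) u 1 by exact: eval_runs (ESnd _ _) _.
apply: runs_le (runs_comp (runs_comp (init _) (loop [::])) (fin _ _)).
by lia.
Qed.

Lemma runs_rev (X : Type) (e : X -> val) (s : seq X) :
  runs rev_prog (enc_seq (map e s)) (enc_seq (map e (rev s)))
    (13 * size s + 10).
Proof.
rewrite map_rev; apply: (@runs_rmap _ _ e e _ 3) => x tl out.
exact: eval_runs (EComp (EFst _ _) (EFst _ _)) _.
Qed.

Lemma runs_zeros (X : Type) (e : X -> val) (s : seq X) :
  runs zeros_prog (enc_seq (map e s)) (enc_seq [seq VReal 0 | _ <- s])
    (11 * size s + 10).
Proof.
(* A constant list is its own reversal, which absorbs the one made by [rmap_prog]. *)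
have -> : [seq VReal (0 : R) | _ <- s] = rev [seq VReal 0 | _ <- s].
  by elim: s => //= x s {1}->; rewrite rev_cons -cats1 -map_rev;
    elim: (rev s) => //= y l <-.
apply: (@runs_rmap _ _ e _ _ 1) => x tl out.
exact: eval_runs (ENat 0 _) _.
Qed.

Lemma runs_threshold (X : Type) (a : X -> R) (s : seq X) :
  runs threshold_prog (enc_seq [seq VReal (a x) | x <- s])
    (enc_seq [seq VBool R (0 < a x) | x <- s]) (30 * size s + 21).
Proof.
have lt0 x tl st : runs (PComp PLt (PPair (PNat 0) (PComp PFst PFst)))
    (VPair (VPair (VReal (a x)) tl) st) (VBool R (0 < a x)) 7.
  apply: eval_runs; first apply: EComp (ELt _ _).
    exact: EPair (ENat 0 _) (EComp (EFst _ _) (EFst _ _)).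
  by [].
have := runs_rev (fun x => VBool R (0 < a x)) (rev s).
rewrite revK map_rev => runsF.
apply: runs_le (runs_comp (runs_rmap s lt0) runsF).
by rewrite size_rev; lia.
Qed.

Lemma runs_vote (X : Type) (b : X -> bool) (a : X -> R) (s : seq X) :
  runs vote_prog
    (VPair (enc_seq [seq VBool R (b x) | x <- s])
           (VPair (enc_seq [seq VReal (a x) | x <- s]) VNil))
    (enc_seq [seq VReal (a x + ((b x)%:R + (b x)%:R - 1)) | x <- s])
    (60 * size s + 20).
Proof.
rewrite /vote_prog; set g := PPair _ (PPair _ _).
set F := fun x => VReal (a x + ((b x)%:R + (b x)%:R - 1)).
have loop out : runs (fold_prog g)
    (VPair (enc_seq [seq VBool R (b x) | x <- s])
           (VPair (enc_seq [seq VReal (a x) | x <- s]) (enc_seq out)))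
    (VPair VNil (VPair VNil (enc_seq (catrev (map F s) out))))
    (47 * size s + 4).
  elim: s out => [|x s IHs] out; first by apply: (runs_le _ (runs_fold_nil _ _)); rewrite leq_addl.
  rewrite /= mulnS; apply: runs_le; last first.
    apply: (runs_fold_cons _ (IHs (F x :: out))).
    (* The constructors compute the exact cost of the loop body, and [leqnn] takes it as the
       bound. *)
    by apply: eval_runs; [repeat econstructor | exact: leqnn].
  by lia.
have fin v v' u : runs (PComp PSnd PSnd) (VPair v (VPair v' u)) u 3.
  exact: eval_runs (EComp (ESnd _ _) (ESnd _ _)) _.
have := runs_rev F (rev s); rewrite revK map_rev => runsF.
apply: runs_le (runs_comp (runs_comp (loop [::]) (fin _ _ _)) runsF).
by rewrite size_rev; lia.
Qed.

(** Each sample votes +1 or -1, so a strict majority is a positive total; the program can thus keep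
    one real score per element. *)
Lemma majority_score n (s : seq {set 'I_n}) i :
  (i \in majority s) =
  (0 < \sum_(S <- s) ((i \in S)%:R + (i \in S)%:R - 1 : R)).
Proof.
have -> : \sum_(S <- s) ((i \in S)%:R + (i \in S)%:R - 1 : R) =
    (2 * count (fun S : {set 'I_n} => i \in S) s)%:R - (size s)%:R.
  elim: s => [|S s IHs]; first by rewrite big_nil muln0 subrr.
  by rewrite big_cons IHs /= mulnDr natrD -addn1 natrD natrM; ring.
by rewrite inE subr_gt0 ltr_nat.
Qed.

Lemma runs_majority_prog (Pi : uproblem R) (M : prog) T n (x : input Pi n)
    (s : seq (n.-tuple R)) :
  (forall w, realizations (inst x) w ->
    runs M (VPair (enc_input x) (enc_values w))
           (enc_set R (mandatory (inst x) w)) T) ->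
  (forall w, w \in s -> realizations (inst x) w) ->
  runs (majority_prog M) (VPair (enc_input x) (enc_seq (map (@enc_values R n) s)))
    (enc_set R (majority (map (mandatory (inst x)) s)))
    ((T + 60 * n + 100) * size s + 60 * n + 100).
Proof.
move=> runsM real_s; rewrite /majority_prog; set g := PPair (PComp PFst PSnd) _.
pose vote w i : R :=
  (i \in mandatory (inst x) w)%:R + (i \in mandatory (inst x) w)%:R - 1.
(* The induction on samples needs arbitrary initial scores [a]; giving the final scores [a'] by a
   pointwise equation avoids rewriting under the encoding. *)
have loop (a a' : 'I_n -> R) :
    (forall i, a' i = a i + \sum_(w <- s) vote w i) -> runs (fold_prog g)
    (VPair (enc_seq (map (@enc_values R n) s))
           (VPair (enc_input x) (enc_seq [seq VReal (a i) | i <- enum 'I_n])))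
    (VPair VNil (VPair (enc_input x)
           (enc_seq [seq VReal (a' i) | i <- enum 'I_n])))
    ((T + 60 * n + 100) * size s + 4).
  elim: s a real_s => [|w s IHs] a real_s a'E.
    have -> : [seq VReal (a' i) | i <- enum 'I_n] =
              [seq VReal (a i) | i <- enum 'I_n].
      by apply: eq_map => i; rewrite a'E big_nil addr0.
    by apply: (runs_le _ (runs_fold_nil _ _)); rewrite leq_addl.
  have runs_env u v v' : runs (PComp PFst PSnd) (VPair u (VPair v v')) v 3.
    exact: eval_runs (EComp (ESnd _ _) (EFst _ _)) _.
  have runs_elt u v v' : runs (PComp PFst PFst) (VPair (VPair u v) v') u 3.
    exact: eval_runs (EComp (EFst _ _) (EFst _ _)) _.
  have runs_acc u v v' :
      runs (PPair (PComp PSnd PSnd) PNil) (VPair u (VPair v v')) (VPair v' VNil) 5.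
    exact: eval_runs (EPair (EComp (ESnd _ _) (ESnd _ _)) (ENil _)) _.
  have {}IHs := IHs (fun i => a i + vote w i)
    (fun w' sw' => real_s w' (mem_behead (s := w :: s) sw')) _.
  have runs_w := runsM w (real_s w (mem_head _ _)).
  have runs_v := runs_vote (fun i => i \in mandatory (inst x) w) a (enum 'I_n).
  apply: runs_le (runs_fold_cons (runs_pair (runs_env _ _ _)
    (runs_comp (runs_pair (runs_comp (runs_pair (runs_env _ _ _)
      (runs_elt _ _ _)) runs_w) (runs_acc _ _ _)) runs_v)) (IHs _)).
    by rewrite size_enum_ord /= mulnS; lia.
  by move=> i; rewrite a'E big_cons addrA.
have runs_sum := loop _ _ (fun i => esym (add0r _)).
have runs_fst u v v' : runs (PComp PFst PFst) (VPair (VPair u v) v') u 3.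
  exact: eval_runs (EComp (EFst _ _) (EFst _ _)) _.
have runs_snd u v v' : runs (PComp PSnd PSnd) (VPair u (VPair v v')) v' 3.
  exact: eval_runs (EComp (ESnd _ _) (ESnd _ _)) _.
have runs_inp u v : runs PFst (VPair u v) u 1 by exact: eval_runs (EFst _ _) _.
have runs_smp u v : runs PSnd (VPair u v) v 1 by exact: eval_runs (ESnd _ _) _.
have runs_t := runs_threshold (fun i => \sum_(w <- s) vote w i) (enum 'I_n).
have -> : enc_set R (majority (map (mandatory (inst x)) s)) =
    enc_seq [seq VBool R (0 < \sum_(w <- s) vote w i) | i <- enum 'I_n].
  by congr enc_seq; apply: eq_map => i; rewrite majority_score big_map.
apply: runs_le (runs_comp (runs_comp (runs_pair (runs_smp _ _)
  (runs_pair (runs_inp _ _) (runs_comp (runs_fst _ _ _) (runs_zeros _ _))))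
  runs_sum) (runs_comp (runs_snd _ _ _) runs_t)).
by rewrite size_enum_ord; lia.
Qed.

End Programs.

(** * Polynomial running time of the learner *)

Lemma leq_horner (p : {poly nat}) (a b : nat) : (a <= b)%N -> (p.[a] <= p.[b])%N.
Proof.
move=> ab; rewrite !horner_coef.
apply: (big_ind2 (fun u v : nat => (u <= v)%N)) => // [u u' v v'|i _].
  exact: leq_add.
by rewrite leq_mul// !natrXE; case: (val i) => // k; rewrite leq_exp2r.
Qed.

Lemma mandatory_learner (R : realType) (Pi : uproblem R) :
  mandatory_polytime Pi ->
  exists (L : prog) (q : {poly nat}), forall n (x : input Pi n) m,
    learner_computes L x
      (fun s : m.-tuple (n.-tuple R) => majority (map (mandatory (inst x)) s))
      q.[(n + m)%N].
Proof.
move=> [M [p runsM]]; exists (majority_prog M).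
(* The bound of [runs_majority_prog] with both [n] and the number of samples replaced by [n + m];
   this uses that [p] is monotone. *)
exists ((p + 60%N%:P * 'X + 100%N%:P) * 'X + 60%N%:P * 'X + 100%N%:P).
move=> n x m s real_s.
suff : runs (majority_prog M)
    (VPair (enc_input x) (enc_seq (map (@enc_values R n) s)))
    (enc_set R (majority (map (mandatory (inst x)) s)))
    ((p.[n] + 60 * n + 100) * size s + 60 * n + 100).
  apply: runs_le; rewrite size_tuple !(hornerD, hornerM, hornerC, hornerX).
  have := leq_horner p (leq_addr m n).
  move: (p.[n]) (p.[(n + m)%N]) => a b ab.
  rewrite -[leqRHS]/((b + 60 * (n + m) + 100) * (n + m) + 60 * (n + m) + 100)%N.
  by do !apply: leq_add => //; rewrite ?leq_mul ?leq_add ?leq_addr ?leq_addl.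
apply: runs_majority_prog => [w /runsM//|w /tnthP[j ->]]; exact: real_s.
Qed.

(* Markov's inequality for [t ^ (votes for c - votes against c)] with
   [t = 1 + a]: in the worst case [f c = (1 - a) / 2] a single vote contributes
   a factor of mean exactly [1 - a ^+ 2 / 2]. *)
Lemma bernoulli_tail (R : realType) m (f : bool -> R) (c : bool) (a : R)
    (E : pred {ffun 'I_m -> bool}) :
  (forall b, 0 <= f b) -> f true + f false = 1 ->
  0 <= a -> f c <= (1 - a) / 2 ->
  (forall b, E b -> (m <= 2 * #|[pred j | b j == c]|)%N) ->
  \sum_(b | E b) \prod_j f (b j) <= expR (- (a ^+ 2 / 2)) ^+ m.
Proof.
move=> f0 f1 a0 fc Em.
pose g b := f b * (if b == c then 1 + a else (1 + a)^-1).
have a1 : 0 < 1 + a by lra.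
have g0 b : 0 <= g b.
  by apply: mulr_ge0 => //; case: ifP => _; rewrite ?invr_ge0 ltW.
have le_tilt b : E b -> \prod_j f (b j) <= \prod_j g (b j).
  (* On [E] at least half of the tilting factors are [1 + a], so their product is at least 1. *)
  move=> /Em mb; rewrite big_split /= -[leLHS]mulr1 ler_wpM2l ?prodr_ge0//.
  rewrite (bigID (fun j => b j == c)) /=.
  rewrite (eq_bigr (fun=> 1 + a)); last by move=> j ->.
  rewrite [X in _ * X](eq_bigr (fun=> (1 + a)^-1)); last by move=> j /negPf ->.
  rewrite !prodr_const exprVn ler_pdivlMr ?exprn_gt0// mul1r.
  apply: ler_weXn2l; first lra.
  have cC : (#|[pred j | b j == c]| + #|[pred j | b j != c]|)%N = m.
    by rewrite -[RHS]card_ord -(cardC [pred j | b j == c]).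
  by rewrite -(leq_add2l #|[pred j | b j == c]|) cC addnn -mul2n.
apply: le_trans (ler_sum _ le_tilt) _.
apply: (@le_trans _ _ (\sum_(b : {ffun 'I_m -> bool}) \prod_j g (b j))).
  rewrite [leRHS](bigID E) /= lerDl; apply: sumr_ge0 => b _.
  exact: prodr_ge0.
(* By distributivity the sum over all vote vectors is the [m]-th power of the mean of one tilted
   vote. *)
rewrite -(bigA_distr_bigA (fun _ : 'I_m => g)) /= prodr_const card_ord.
apply: lerXn2r; rewrite ?nnegrE ?expR_ge0 ?sumr_ge0//.
apply: le_trans (expR_ge1Dx _).
have -> : \sum_b g b = f c * (1 + a) + (1 - f c) / (1 + a).
  rewrite big_bool /g; case: c {fc Em le_tilt g0 g} => /=; rewrite -f1; ring.
have -> : 1 + - (a ^+ 2 / 2) = (1 - a) / 2 * (1 + a) + (1 + a) / 2 / (1 + a).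
  by field; rewrite gt_eqF.
(* The gap to the worst case factors as the slack in [f c] times a nonnegative number. *)
rewrite -subr_ge0.
have -> : (1 - a) / 2 * (1 + a) + (1 + a) / 2 / (1 + a) -
   (f c * (1 + a) + (1 - f c) / (1 + a)) =
   ((1 - a) / 2 - f c) * (a * (2 + a) / (1 + a)).
  by field; rewrite gt_eqF.
by rewrite mulr_ge0 ?divr_ge0 ?mulr_ge0//; lra.
Qed.

(** * Random variables with finitely many values *)

Lemma measurable_finite_preimage d (Om : measurableType d) (X : finType)
    (F : Om -> X) (E : set X) :
  (forall x, measurable (F @^-1` [set x])) -> measurable (F @^-1` E).
Proof.
move=> mF; have -> : F @^-1` E = \bigcup_(x in E) F @^-1` [set x].
  by apply/seteqP; split => [om Eom|om [x Ex /= Fx]]; [exists (F om) | rewrite /preimage /= Fx].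
by apply: fin_bigcup_measurable => //; exact: finite_finset.
Qed.

Lemma probability_finite_preimage (R : realType) d (Om : measurableType d)
    (Pr : probability Om R) (X : finType) (F : Om -> X) (E : pred X) :
  (forall x, measurable (F @^-1` [set x])) ->
  Pr (F @^-1` [set x | E x]) = (\sum_(x | E x) Pr (F @^-1` [set x]))%E.
Proof.
move=> mF; have -> : F @^-1` [set x | E x] =
    \bigcup_(x in [set x | E x]) F @^-1` [set x].
  by apply/seteqP; split => [om Eom|om [x Ex /= Fx]]; [exists (F om) | rewrite /preimage /= Fx].
rewrite measure_fin_bigcup//; last by move=> x y _ _ [om [/= <- <-]].
  rewrite -[RHS]big_filter [RHS]fsbig_seq ?filter_uniq ?index_enum_uniq//=.
  by apply: eq_fsbigl; apply/seteqP; split => x /=;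
    rewrite mem_filter mem_index_enum andbT.
exact: finite_finset.
Qed.


Lemma in_majority_tuple (T : Type) n (S : T -> {set 'I_n}) m (W : 'I_m -> T) i :
  (i \in majority [seq S w | w <- [tuple W j | j < m]]) =
  (m < 2 * #|[pred j | i \in S (W j)]|)%N.
Proof.
rewrite inE size_map size_tuple count_map; congr (_ < 2 * _)%N.
by rewrite /= count_map enumT cardE /enum_mem size_filter.
Qed.

(** * Risk and law of the majority vote on a random set *)

Section RandomSet.
Context (R : realType) (d' : measure_display) (T : measurableType d')
  (D : probability T R) (n : nat) (S : T -> {set 'I_n}).
Hypothesis mS : forall i, measurable [set w | i \in S w].

Definition bit_prob (i : 'I_n) (b : bool) : R := fine (D [set w | (i \in S w) = b]).

Lemma measurable_bit i b : measurable [set w | (i \in S w) = b].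
Proof.
case: b; first exact: mS.
have -> : [set w | (i \in S w) = false] = ~` [set w | i \in S w].
  by apply/seteqP; split => w /= /negP; rewrite ?negbK // => /negbTE.
exact/measurableC/mS.
Qed.

Lemma bit_probE i b : (bit_prob i b)%:E = D [set w | (i \in S w) = b].
Proof. by rewrite /bit_prob fineK// fin_num_measure//; exact: measurable_bit. Qed.

Lemma bit_prob_ge0 i b : 0 <= bit_prob i b.
Proof. by rewrite fine_ge0. Qed.

Lemma bit_probD1 i : bit_prob i true + bit_prob i false = 1.
Proof.
apply: EFin_inj; rewrite EFinD !bit_probE -measureU; try exact: measurable_bit.
  by rewrite -(probability_setT D); congr (D _); apply/seteqP; split => // w _ /=;
    case: (i \in S w); [left | right].
by apply/seteqP; split => // w [/= ->].
Qed.

(** Linearity of expectation: [i] is in the symmetric difference exactly when its membership bit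
    equals [i \notin P]. *)
Lemma expected_kM P :
  ('E_D[fun w => (kM (S w) P)%:R] = (\sum_i bit_prob i (i \notin P))%:E)%E.
Proof.
have kME w : (kM (S w) P)%:R =
    \sum_i \1_[set w | (i \in S w) = (i \notin P)] w :> R.
  rewrite /kM -sum1_card natr_sum big_mkcond /=; apply: eq_bigr => i _.
  have -> : \1_[set w | (i \in S w) = (i \notin P)] w =
      ((i \in S w) == (i \notin P))%:R :> R.
    by rewrite indicE; congr ((nat_of_bool _)%:R); apply/idP/eqP; rewrite inE.
  by rewrite !inE; case: (i \in P); case: (i \in S w).
rewrite unlock; under eq_integral do rewrite kME -sumEFin.
rewrite ge0_integral_sum//; last first.
  by move=> i; apply/measurable_EFinP/measurable_indic/measurable_bit.
rewrite -sumEFin; apply: eq_bigr => i _.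
by rewrite integral_indic// ?setIT ?bit_probE//; exact: measurable_bit.
Qed.

Context (d : measure_display) (Om : measurableType d) (Pr : probability Om R)
  (m : nat) (W : 'I_m -> Om -> T).
Hypothesis iidW : iid Pr D W.

Let vote om : {set 'I_n} := majority [seq S w | w <- [tuple W j om | j < m]].

(** The votes on one fixed [i]. They are independent over the samples [j], while different [i] may
    be correlated. *)
Let bits i om : {ffun 'I_m -> bool} := [ffun j => i \in S (W j om)].

Let mem_vote i om : (i \in vote om) = (m < 2 * #|[pred j | bits i om j]|)%N.
Proof.
rewrite in_majority_tuple; congr (_ < 2 * _)%N.
by apply: eq_card => j; rewrite !inE ffunE.
Qed.

Let bitsE i b : bits i @^-1` [set b] =
  \bigcap_(j in [set` [set: 'I_m]%SET]) (W j @^-1` [set w | (i \in S w) = b j]).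
Proof.
apply/seteqP; split => om /=.
  by move=> <- j _ /=; rewrite ffunE.
by move=> h; apply/ffunP => j; rewrite ffunE; apply: h; rewrite /= finset.in_setT.
Qed.

Lemma measurable_bits i b : measurable (bits i @^-1` [set b]).
Proof.
rewrite bitsE; apply: fin_bigcap_measurable => [|j _]; first exact: finite_finset.
have [mW _ _] := iidW.
by rewrite -[X in measurable X]setTI; apply: mW => //; exact: measurable_bit.
Qed.

Lemma bits_law i b :
  Pr (bits i @^-1` [set b]) = (\prod_j bit_prob i (b j))%:E.
Proof.
have [mW lawW indW] := iidW.
rewrite bitsE indW => [|j]; last exact: measurable_bit.
rewrite -prodEFin; apply: eq_big => [j|j _]; first by rewrite finset.in_setT.
by rewrite lawW ?bit_probE//; exact: measurable_bit.
Qed.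

Lemma measurable_vote (E : set {set 'I_n}) : measurable (vote @^-1` E).
Proof.
apply: measurable_finite_preimage => Q.
have -> : vote @^-1` [set Q] = \bigcap_(i in [set: 'I_n])
    bits i @^-1` [set b | (i \in Q) = (m < 2 * #|[pred j | b j]|)%N].
  apply/seteqP; split => om /=.
    by move=> <- i _ /=; rewrite mem_vote.
  by move=> h; apply/setP => i; rewrite mem_vote; apply/esym/h.
apply: fin_bigcap_measurable => [|i _]; first exact: finite_finset.
by apply: measurable_finite_preimage => b; exact: measurable_bits.
Qed.

(** The two bit probabilities sum to 1 and [a] is nonnegative, so at most one answer [c] lies below
    [(1 - a) / 2]. The event says that the vote is [c], and [bernoulli_tail] bounds it. *)
Lemma vote_unlikely i (a : R) : 0 <= a ->
  (Pr [set om | (bit_prob i (i \in vote om) < (1 - a) / 2)%R]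
    <= (expR (- (a ^+ 2 / 2)) ^+ m)%:E)%E.
Proof.
move=> a0.
pose E (b : {ffun 'I_m -> bool}) :=
  bit_prob i (m < 2 * #|[pred j | b j]|)%N < (1 - a) / 2.
have -> : [set om | bit_prob i (i \in vote om) < (1 - a) / 2] =
    bits i @^-1` [set b | E b].
  by apply/seteqP; split => om; rewrite /= /E mem_vote.
rewrite probability_finite_preimage; last by move=> b; exact: measurable_bits.
under eq_bigr do rewrite bits_law.
rewrite sumEFin lee_fin.
have f1 := bit_probD1 i; have f0 := bit_prob_ge0 i.
have [c fc] : exists c, E =1 xpred0 \/
    bit_prob i c < (1 - a) / 2 /\ (1 - a) / 2 <= bit_prob i (~~ c).
  have [ft|ft] := ltP (bit_prob i true) ((1 - a) / 2).
    by exists true; right; split => //=; lra.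
  have [ff|ff] := ltP (bit_prob i false) ((1 - a) / 2).
    by exists false; right; split => //=.
  (* Neither answer is unlikely: the event is empty and [true] is a dummy value. *)
  exists true; left => b; apply/negbTE; rewrite -leNgt.
  by case: (m < _)%N.
case: fc => [E0|[fc fc']].
  by rewrite big_pred0 // exprn_ge0 ?expR_ge0.
apply: (@bernoulli_tail _ _ _ c) => // [|b]; first exact: ltW.
rewrite /E; case: c fc fc' => /= fc fc'.
  case: ltnP => [mb _|_]; last by lra.
  have -> : #|[pred j | b j == true]| = #|[pred j | b j]|.
    by apply: eq_card => j; rewrite !inE eqb_id.
  exact: ltnW.
(* A tie is a vote for [false], so here only the non-strict bound on the count holds. *)
case: ltnP => [_|mb _]; first by lra.
have cC : (#|[pred j | b j]| + #|[pred j | b j == false]|)%N = m.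
  rewrite -[RHS]card_ord -(cardC [pred j | b j]); congr (_ + _)%N.
  by apply: eq_card => j; rewrite !inE eqbF_neg.
move: cC mb; move: #|[pred j | b j]| #|[pred j | b j == false]| => k k'.
by lia.
Qed.

(** Union bound over the [n] elements. [G] is later taken to be the set of predictions with nearly
    optimal risk. *)
Lemma vote_good (a : R) (G : set {set 'I_n}) : 0 <= a ->
  (forall Q : {set 'I_n}, (forall i, (1 - a) / 2 <= bit_prob i (i \in Q)) -> G Q) ->
  ((1 - n%:R * expR (- (a ^+ 2 / 2)) ^+ m)%:E <= Pr (vote @^-1` G))%E.
Proof.
move=> a0 goodG.
pose bad i := [set om | bit_prob i (i \in vote om) < (1 - a) / 2].
have mbad i : measurable (bad i).
  exact: (measurable_vote [set Q : {set 'I_n} | bit_prob i (i \in Q) < (1 - a) / 2]).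
have mG := measurable_vote G.
have badG : ~` (vote @^-1` G) `<=` \bigcup_(i in [set: 'I_n]) bad i.
  move=> om /= nG; apply: contrapT => nbad; apply/nG/goodG => i.
  by rewrite leNgt; apply/negP => b; apply: nbad; exists i.
have : (Pr (~` (vote @^-1` G)) <= (n%:R * expR (- (a ^+ 2 / 2)) ^+ m)%:E)%E.
  have := @content_sub_fsum _ _ _ Pr _ [set: 'I_n] _ bad finite_finset
    (fun i _ => mbad i) (measurableC mG) badG.
  move=> /le_trans; apply.
  rewrite (fsbigE (index_enum 'I_n))//; last 2 first.
    exact: index_enum_uniq.
    by move=> i _; rewrite mem_index_enum.
  apply: (@le_trans _ _ (\sum_(i < n) (expR (- (a ^+ 2 / 2)) ^+ m)%:E)%E).
    rewrite big_mkcond /=; apply: lee_sum => i _; rewrite ifT ?inE//.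
    exact: vote_unlikely.
  by rewrite sumEFin sumr_const card_ord mulr_natl.
rewrite probability_setC// => le_bad.
have Pfin : Pr (vote @^-1` G) \is a fin_num by rewrite fin_num_measure.
move: le_bad; rewrite -(fineK Pfin) -EFinB !lee_fin; lra.
Qed.

(** Where [P] and [Q] differ at [i], [Q] errs with probability at most [(1 + a) / 2] and [P] with at
    least [(1 - a) / 2]: an excess of at most [a] per element. *)
Lemma expected_kM_le (a : R) (P Q : {set 'I_n}) : 0 <= a ->
  (forall i, (1 - a) / 2 <= bit_prob i (i \in Q)) ->
  ('E_D[fun w => (kM (S w) Q)%:R] <=
     'E_D[fun w => (kM (S w) P)%:R] + (n%:R * a)%:E)%E.
Proof.
move=> a0 hQ; rewrite !expected_kM -EFinD lee_fin.
have -> : n%:R * a = \sum_(i < n) a by rewrite sumr_const card_ord mulr_natl.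
rewrite -big_split /=; apply: ler_sum => i _.
have := hQ i; have := bit_probD1 i; have := bit_prob_ge0 i.
by case: (i \in P); case: (i \in Q) => /= f0 f1; have := f0 true; have := f0 false; lra.
Qed.

End RandomSet.

(** * Choice of the sample size *)

(** The interval has length [y], hence contains an integer; this rounds the sample size without an
    additive constant. *)
Lemma exists_nat_between (R : realType) (y : R) :
  y = 0 \/ 1 <= y -> exists m : nat, 2 * y <= m%:R <= 3 * y.
Proof.
case=> [->|y1]; first by exists 0%N; rewrite !mulr0 lexx.
exists (Num.truncn (2 * y)).+1.
have /truncn_itv/andP[lo_y hi_y] : 0 <= 2 * y by lra.
by rewrite (ltW hi_y) -natr1; lra.
Qed.

(** The exponent reaches [n%:R - ln delta], so each tail is at most [expR (- n%:R) * delta], and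
    [n <= expR n] pays for the union bound. *)
Lemma sample_size_tail (R : realType) (n m : nat) (eps delta : R) :
  0 < eps -> 0 < delta ->
  2 * ((n%:R - ln delta) * n%:R ^+ 2 / eps ^+ 2) <= m%:R ->
  n%:R * expR (- ((eps / n%:R) ^+ 2 / 2)) ^+ m <= delta.
Proof.
move=> eps0 delta0 le_m.
case: n => [|n] in le_m *; first by rewrite mul0r ltW.
have n0 : 0 < n.+1%:R :> R by rewrite ltr0n.
have le_exp : expR (- ((eps / n.+1%:R) ^+ 2 / 2)) ^+ m <=
    expR (- n.+1%:R) * delta.
  rewrite -expRM_natr -[X in _ <= _ * X](lnK delta0) -expRD ler_expR.
  have : 0 <= (eps / n.+1%:R) ^+ 2 / 2 by rewrite divr_ge0// sqr_ge0.
  move/ler_wpM2l/(_ _ _ le_m).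
  have -> : (eps / n.+1%:R) ^+ 2 / 2 *
      (2 * ((n.+1%:R - ln delta) * n.+1%:R ^+ 2 / eps ^+ 2)) = n.+1%:R - ln delta.
    by field; rewrite !gt_eqF.
  by move=> le_exp; rewrite mulNr lerNl opprD opprK.
apply: (le_trans (ler_wpM2l (ltW n0) le_exp)).
rewrite mulrA; apply: ler_piMl; first exact: ltW.
rewrite expRN ler_pdivrMr ?expR_gt0// mul1r.
by apply: le_trans (expR_ge1Dx _); lra.
Qed.

Theorem theorem6 (R : realType) :
  exists2 C : R, 0 < C &
  forall Pi : uproblem R, mandatory_polytime Pi ->
  exists (L : prog) (q : {poly nat}),
  forall (n : nat) (x : input Pi n) (eps delta : R),
    measurable_mandatory (inst x) ->
    0 < eps < 1 -> 0 < delta < 1 ->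
  exists (m : nat) (A : m.-tuple (n.-tuple R) -> {set 'I_n}),
    [/\ m%:R <= C * ((n%:R - ln delta) * n%:R ^+ 2 / eps ^+ 2),
        learner_computes L x A q.[(n + m)%N] &
        forall (D : probability (n.-tuple R) R),
          D (realizations (inst x)) = 1%E ->
        forall (d : measure_display) (Om : measurableType d)
               (Pr : probability Om R) (W : 'I_m -> Om -> n.-tuple R),
          iid Pr D W ->
          let good := [set om : Om |
            (risk (inst x) D (A [tuple W j om | j < m])
             <= risk (inst x) D (opt_prediction (inst x) D) + eps%:E)%E] in
          measurable good /\ ((1 - delta)%:E <= Pr good)%E].
Proof.
(* The constant is the upper end of the interval [[2 * y, 3 * y]] in which [m] is chosen. *)
exists 3 => // Pi /mandatory_learner[L [q runsL]]; exists L, q.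
move=> n x eps delta mI /andP[eps0 eps1] /andP[delta0 delta1].
set y := (n%:R - ln delta) * n%:R ^+ 2 / eps ^+ 2.
have ln_delta : ln delta < 0 by apply: ln_lt0; rewrite delta0.
have [m /andP[m_ge m_le]] : exists m : nat, 2 * y <= m%:R <= 3 * y.
  apply: exists_nat_between; rewrite /y; case: n {x y mI} => [|n].
    by left; rewrite expr0n mulr0 mul0r.
  right; have n1 : 1 <= n.+1%:R :> R by rewrite ler1n.
  have n2 : 1 <= n.+1%:R ^+ 2 :> R by rewrite exprn_ege1.
  have e2 : eps ^+ 2 <= 1 by rewrite exprn_ile1 ?ltW.
  rewrite ler_pdivlMr ?exprn_gt0// mul1r (le_trans e2)//; nra.
exists m, (fun s => majority (map (mandatory (inst x)) s)).
split=> // D _ d Om Pr W iidW good.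
(* With tolerance [eps / n] per element the total excess is [eps]; for [n = 0] the quotient is 0 by
   convention and so is the excess. *)
have a0 : 0 <= eps / n%:R by rewrite divr_ge0// ltW.
pose G := [set Q | (risk (inst x) D Q <=
  risk (inst x) D (opt_prediction (inst x) D) + eps%:E)%E].
split; first exact: (measurable_vote mI iidW G).
apply: le_trans (vote_good (G := G) mI iidW a0 _) => [|Q hQ].
  by rewrite lee_fin lerD2l lerN2; exact: sample_size_tail.
apply: le_trans (expected_kM_le mI _ a0 hQ) _.
apply: leeD2l; rewrite lee_fin.
case: n {x y mI m_ge m_le a0 W iidW good G hQ runsL D Q} => [|n].
  by rewrite mul0r ltW.
by rewrite mulrC divfK// pnatr_eq0.
Qed.
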